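(* Let $d\ge 1$. For every corner $c$ of $[0,1]^d$, every $n\ge 1$, and every sample $X_1,\dots,X_n\in[0,1]^d$, $$\omega^2_c=\frac{1}{n^2}\sum_{i,j=1}^n \mathrm{pairFactor}_c(X_i,X_j)-\frac{2}{n}\sum_{i=1}^n \mathrm{crossFactor}_c(X_i)+\left(\frac13\right)^d .$$
   Context: A corner of $[0,1]^d$ is a function $c:\{0,\dots,d-1\}\to\{\mathrm{true},\mathrm{false}\}$. For a corner $c$ and $x\in[0,1]^d$, let $\mathrm{cornerLe}(c,x)=\{s\in[0,1]^d:\ \text{for all }k,\ s_k\ge x_k\text{ if }c(k)=\mathrm{true},\ s_k\le x_k\text{ if }c(k)=\mathrm{false}\}$. For a (deterministic) sample $X_1,\dots,X_n\in[0,1]^d$ put $F_n^c(x)=\frac1n\sum_{i=1}^n\mathbf 1\{X_i\in\mathrm{cornerLe}(c,x)\}$, and put $F^c(x)=\prod_{k=0}^{d-1}g_k(x)$ with $g_k(x)=1-x_k$ if $c(k)=\mathrm{true}$ and $g_k(x)=x_k$ if $c(k)=\mathrm{false}$. Define $\omega^2_c=\int_{[0,1]^d}(F_n^c(x)-F^c(x))^2\,dx$. For $t\in[0,1]$ let $\mathrm{reflect}_{c,k}(t)=1-t$ if $c(k)=\mathrm{true}$ and $=t$ otherwise. For $a,b\in[0,1]^d$ define $\mathrm{pairFactor}_c(a,b)=\prod_{k=0}^{d-1}\bigl(1-\max(\mathrm{reflect}_{c,k}(a_k),\mathrm{reflect}_{c,k}(b_k))\bigr)$ and $\mathrm{crossFactor}_c(a)=\prod_{k=0}^{d-1}\frac{1-\mathrm{reflect}_{c,k}(a_k)^2}{2}$.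 *)

(* Defs.v *)
From HB Require Import structures.
From mathcomp Require Import all_boot all_order all_algebra.
From mathcomp Require Import all_classical all_reals all_analysis.

Set Implicit Arguments.
Unset Strict Implicit.
Unset Printing Implicit Defensive.

Import Order.TTheory GRing.Theory Num.Theory.
Local Open Scope classical_set_scope.
Local Open Scope ring_scope.

(* R^d as tuples; [measurableTypeR R] is R with its Borel sigma-algebra, and
   the library equips tuples with the product sigma-algebra. *)
Notation Rtuple R d := (d.-tuple (measurableTypeR R)).

Section lebesgue_tuple.
Context {R : realType}.

Definition cons_point d (p : measurableTypeR R * Rtuple R d) : Rtuple R d.+1 :=
  [tuple of p.1 :: p.2].

Lemma measurable_cons_point d : measurable_fun setT (@cons_point d).
Proof. exact: measurable_cons. Qed.

HB.instance Definition _ d :=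
  isMeasurableFun.Build _ _ _ _ (@cons_point d) (@measurable_cons_point d).

Lemma tnth_cons_point d (p : measurableTypeR R * Rtuple R d) (k : 'I_d) :
  tnth (cons_point p) (lift ord0 k) = tnth p.2 k.
Proof. exact: tnthS. Qed.

Section step.
Context (d : nat) (mu : {sigma_finite_measure set (Rtuple R d) -> \bar R}).

Definition lebesgue_cons : set (Rtuple R d.+1) -> \bar R :=
  pushforward (lebesgue_measure \x mu)%E (@cons_point d).

Let lebesgue_cons0 : lebesgue_cons set0 = 0%E.
Proof. exact: measure0. Qed.

Let lebesgue_cons_ge0 A : (0 <= lebesgue_cons A)%E.
Proof. exact: measure_ge0. Qed.

Let lebesgue_cons_sigma_additive : semi_sigma_additive lebesgue_cons.
Proof. exact: measure_semi_sigma_additive. Qed.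

HB.instance Definition _ := isMeasure.Build _ _ _ lebesgue_cons
  lebesgue_cons0 lebesgue_cons_ge0 lebesgue_cons_sigma_additive.

Let uncons (x : Rtuple R d.+1) : measurableTypeR R * Rtuple R d :=
  (thead x, [tuple of behead x]).

Let measurable_uncons : measurable_fun setT uncons.
Proof.
apply/measurable_fun_pairP; split; last exact: measurable_behead.
exact: measurable_tnth.
Qed.

Let uncons_cons p : uncons (cons_point p) = p.
Proof. by case: p => a x; congr pair; apply/val_inj. Qed.

Lemma lebesgue_cons_sigma_finite : sigma_finite setT lebesgue_cons.
Proof.
have /sigma_finiteP[F [FT ndF Foo]] := sigma_finiteT (@lebesgue_measure R).
have /sigma_finiteP[G [GT ndG Goo]] := sigma_finiteT mu.
exists (fun i => uncons @^-1` (F i `*` G i)) => [|i].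
  rewrite -preimage_bigcup -[LHS](preimage_setT uncons); congr (_ @^-1` _).
  apply/seteqP; split => // -[a x] _.
  have [i _ Fia] : (\bigcup_i F i) a by rewrite -FT.
  have [j _ Gjx] : (\bigcup_i G i) x by rewrite -GT.
  exists (maxn i j) => //; split.
    by move: Fia; exact/subsetPset/ndF/leq_maxl.
  by move: Gjx; exact/subsetPset/ndG/leq_maxr.
have [mFi Fioo] := Foo i; have [mGi Gioo] := Goo i; split.
  rewrite -[X in measurable X]setTI; apply: measurable_uncons => //.
  exact: measurableX.
rewrite /lebesgue_cons /pushforward.
rewrite -comp_preimage (_ : uncons \o _ = id); last exact/funext/uncons_cons.
rewrite preimage_id.
by rewrite product_measure1E// lte_mul_pinfty// ge0_fin_numE.
Qed.

HB.instance Definition _ :=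
  Measure_isSigmaFinite.Build _ _ _ lebesgue_cons lebesgue_cons_sigma_finite.

End step.

(* Lebesgue measure on R^d, as the d-fold product of [lebesgue_measure]. *)
Fixpoint lebesgue_tuple d : {sigma_finite_measure set (Rtuple R d) -> \bar R} :=
  match d with
  | 0 => \d_([tuple] : Rtuple R 0)
  | d'.+1 => lebesgue_cons (lebesgue_tuple d')
  end.

Lemma lebesgue_tuple_box d (A : 'I_d -> set (measurableTypeR R)) :
  (forall k, measurable (A k)) ->
  lebesgue_tuple d [set x | forall k, A k (tnth x k)] =
  (\prod_(k < d) lebesgue_measure (A k))%E.
Proof.
elim: d A => [|d IH] A mA.
  rewrite big_ord0 /= /dirac indicE (_ : [set _ | _] = setT) ?in_setT//.
  by apply/seteqP; split => // x _ [].
rewrite big_ord_recl -(IH (fun k => A (lift ord0 k))); last by move=> k.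
rewrite /= /lebesgue_cons /pushforward.
have -> : @cons_point d @^-1` [set x | forall k, A k (tnth x k)] =
    A ord0 `*` [set x | forall k, A (lift ord0 k) (tnth x k)].
  apply/seteqP; split => -[a x] /=.
    move=> Aax; split; first exact: (Aax ord0).
    by move=> k; rewrite -(tnth_cons_point (a, x)); exact: Aax.
  move=> [Aa Ax] k; case: (unliftP ord0 k) => [j|] -> //.
  by rewrite (tnth_cons_point (a, x)).
rewrite product_measure1E//.
rewrite (_ : [set _ | _] = \bigcap_(k in [set: 'I_d])
    ((fun x : Rtuple R d => tnth x k) @^-1` A (lift ord0 k))); last first.
  by apply/seteqP; split => x Ax k; [move=> _; exact: Ax|exact: (Ax k)].
apply: fin_bigcap_measurable => // k _.
by rewrite -[X in measurable X]setTI; exact: measurable_tnth.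
Qed.

End lebesgue_tuple.

Section corner_discrepancy.
Context {R : realType}.

Definition unit_cube d : set (Rtuple R d) :=
  [set x | forall k, 0 <= tnth x k <= 1].

Definition corner d := 'I_d -> bool.

Definition cornerLe d (c : corner d) (x : Rtuple R d) : set (Rtuple R d) :=
  [set s | unit_cube s /\
    forall k, if c k then tnth x k <= tnth s k else tnth s k <= tnth x k].

Definition cdf_emp d (c : corner d) n (X : 'I_n -> Rtuple R d) (x : Rtuple R d) : R :=
  n%:R^-1 * \sum_(i < n) \1_(cornerLe c x) (X i).

Definition cdf_unif d (c : corner d) (x : Rtuple R d) : R :=
  \prod_(k < d) (if c k then 1 - tnth x k else tnth x k).

Definition omega2 d (c : corner d) n (X : 'I_n -> Rtuple R d) : R :=
  \int[lebesgue_tuple d]_(x in @unit_cube d) (cdf_emp c X x - cdf_unif c x) ^+ 2.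

Definition corner_reflect d (c : corner d) (k : 'I_d) (t : R) : R :=
  if c k then 1 - t else t.

Definition pairFactor d (c : corner d) (a b : Rtuple R d) : R :=
  \prod_(k < d) (1 - Num.max (corner_reflect c k (tnth a k))
                             (corner_reflect c k (tnth b k))).

Definition crossFactor d (c : corner d) (a : Rtuple R d) : R :=
  \prod_(k < d) ((1 - corner_reflect c k (tnth a k) ^+ 2) / 2).

End corner_discrepancy.

(* Main.v *)
Require Import Defs.
From mathcomp Require Import all_boot all_order all_algebra.
From mathcomp Require Import all_classical all_reals all_analysis.
From mathcomp Require Import measurable_realfun ring.
Import Order.TTheory GRing.Theory Num.Theory.
Import numFieldNormedType.Exports.
Local Open Scope classical_set_scope.
Local Open Scope ring_scope.

(* Expanding the square gives three kinds of terms, all of the form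
   1{m in cornerLe c x} F^c(x)^e with a point m of the cube: m = X_i "met" with
   X_j and e = 0 for the pairs, m = X_i and e = 1 for the cross terms, and m the
   corner itself and e = 2 for the last one. Such a term is a product of
   functions of the single coordinates, so by Tonelli its integral is the
   product over k of (1 - reflect_(c, k) (m_k) ^ (e + 1)) / (e + 1). *)

(** * Integrals of polynomials and of products of one-variable functions *)

Lemma integral_deriv_horner (R : realType) (P : {poly R}) (a b : R) : a <= b ->
  (\int[lebesgue_measure]_(x in `[a, b]) (P^`().[x])%:E = (P.[b] - P.[a])%:E)%E.
Proof.
(* The fundamental theorem is applied for [a < b]; on the degenerate interval both sides are
   zero. *)
rewrite le_eqVlt => /predU1P[<-|ab]; first by rewrite set_itv1 integral_set1 subrr.
rewrite (@continuous_FTC2 _ _ (horner P)) ?EFinB//.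
- by apply: continuous_subspaceT => x; exact: continuous_horner.
- split.
  + by move=> x _; exact: derivable_horner.
  + by apply: cvg_at_right_filter; exact: continuous_horner.
  + by apply: cvg_at_left_filter; exact: continuous_horner.
- by move=> x _; rewrite derivE.
Qed.

(** By induction on [d]: the measure in dimension [d.+1] is a pushforward of a product measure under
    [cons_point], so Tonelli splits off the first coordinate. Nonnegativity replaces any
    integrability assumption. *)
Lemma integral_lebesgue_tuple_prod (R : realType) d (f : 'I_d -> R -> R) :
    (forall k, measurable_fun setT (f k)) -> (forall k x, 0 <= f k x) ->
  (\int[lebesgue_tuple d]_x (\prod_(k < d) f k (tnth x k))%:E =
   \prod_(k < d) \int[lebesgue_measure]_x (f k x)%:E)%E.
Proof.
have mprod n (g : 'I_n -> R -> R) : (forall k, measurable_fun setT (g k)) ->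
    measurable_fun setT (fun x : Rtuple R n => \prod_(k < n) g k (tnth x k)).
  move=> mg; apply: measurable_prod => k _.
  by apply: measurableT_comp (mg k) _; exact: measurable_tnth.
elim: d f => [|d IH] f mf f0.
  (* In dimension 0 the measure is the Dirac mass at the empty tuple, and both products are
     empty. *)
  rewrite /= integral_dirac ?diracE ?in_setT ?mul1e ?big_ord0//.
  by apply/measurable_EFinP; exact: mprod.
rewrite /= ge0_integral_pushforward//; first last.
- by move=> x _; rewrite lee_fin prodr_ge0.
- by apply/measurable_EFinP; exact: mprod.
rewrite preimage_setT fubini_tonelli1; first last.
- by move=> x; rewrite lee_fin prodr_ge0.
- apply/measurable_EFinP; apply: measurableT_comp (mprod _ _ mf) _.
  exact: measurable_cons_point.
rewrite big_ord_recl -(IH (fun k => f (lift ord0 k)))//.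
have int_ge0 : (0 <= \int[lebesgue_tuple d]_y
    (\prod_(k < d) f (lift ord0 k) (tnth y k))%:E)%E.
  by apply: integral_ge0 => y _; rewrite lee_fin prodr_ge0.
rewrite -ge0_integralZr//; first last.
- by move=> x _; rewrite lee_fin f0.
- by apply/measurable_EFinP; exact: mf.
apply: eq_integral => a _; rewrite /fubini_F /=.
rewrite -ge0_integralZl//; first last.
- by rewrite lee_fin.
- by move=> y _; rewrite lee_fin prodr_ge0.
- by apply/measurable_EFinP; exact: (mprod _ (fun k => f (lift ord0 k))).
apply: eq_integral => y _; rewrite big_ord_recl EFinM; congr (_ * _%:E)%E.
by apply: eq_bigr => k _; rewrite (tnth_cons_point (a, y)).
Qed.

Lemma measurable_unit_cube (R : realType) d : measurable (@unit_cube R d).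
Proof.
rewrite (_ : @unit_cube R d = \bigcap_(k in [set: 'I_d])
    ((fun x : Rtuple R d => tnth x k) @^-1` `[0, 1]%classic)).
  apply: fin_bigcap_measurable => // k _.
  by rewrite -[X in measurable X]setTI; exact: measurable_tnth.
apply/seteqP; split => x /= Qx k; first by move=> _ /=; rewrite in_itv/= Qx.
by have := Qx k Logic.I; rewrite /= in_itv.
Qed.

(** Extending each [f k] by zero outside [0, 1] extends their product by zero outside the cube,
    which reduces the claim to the whole space. *)
Lemma integral_unit_cube_prod (R : realType) d (f : 'I_d -> R -> R) :
    (forall k, measurable_fun setT (f k)) ->
    (forall k x, 0 <= x <= 1 -> 0 <= f k x) ->
  (\int[lebesgue_tuple d]_(x in @unit_cube R d) (\prod_(k < d) f k (tnth x k))%:E =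
   \prod_(k < d) \int[lebesgue_measure]_(x in `[0%R, 1%R]) (f k x)%:E)%E.
Proof.
move=> mf f0.
rewrite integral_mkcond.
under [RHS]eq_bigr => k _.
  rewrite integral_mkcond restrict_EFin; over.
rewrite -integral_lebesgue_tuple_prod; first last.
- move=> k x; rewrite patchE; case: ifPn => //.
  by rewrite inE/= in_itv/=; exact: f0.
- by move=> k; apply/(measurable_restrictT _ _).1 => //; exact: measurable_funTS.
apply: eq_integral => x _; rewrite restrict_EFin /=; congr EFin.
rewrite patchE; case: ifPn => [|]; rewrite ?inE ?notin_setE => Qx.
  by apply: eq_bigr => k _; rewrite patchE mem_set//= in_itv/= Qx.
(* Outside the cube some coordinate leaves [0, 1], and its factor vanishes. *)
have /existsNP[k Qxk] := Qx.
by rewrite (bigD1 k)//= patchE memNset ?mul0r//=.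
Qed.

(** * Finite sums of integrable real functions *)

Lemma integrable_sum_EFin {d} {T : measurableType d} {R : realType}
    (mu : {measure set T -> \bar R}) (D : set T) (I : Type) (s : seq I)
    (f : I -> T -> R) : measurable D ->
    (forall i, mu.-integrable D (EFin \o f i)) ->
  mu.-integrable D (EFin \o (fun x => \sum_(i <- s) f i x)).
Proof.
move=> mD intf.
apply: (eq_integrable mD (fun x => \sum_(i <- s) (f i x)%:E)%E).
  by move=> x _ /=; rewrite sumEFin.
exact: (integrable_sum mD s (fun i _ => intf i)).
Qed.

Lemma Rintegral_sum {d} {T : measurableType d} {R : realType}
    (mu : {measure set T -> \bar R}) (D : set T) (I : Type) (s : seq I)
    (f : I -> T -> R) : measurable D ->
    (forall i, mu.-integrable D (EFin \o f i)) ->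
  \int[mu]_(x in D) (\sum_(i <- s) f i x) = \sum_(i <- s) \int[mu]_(x in D) f i x.
Proof.
move=> mD intf; apply: EFin_inj; rewrite -sumEFin /Rintegral.
have intE : (\int[mu]_(x in D) (\sum_(i <- s) f i x)%:E =
    \int[mu]_(x in D) \sum_(i <- s) (f i x)%:E)%E.
  by apply: eq_integral => x _; rewrite sumEFin.
rewrite intE fineK.
  rewrite integral_sum//; apply: eq_bigr => i _.
  by rewrite fineK//; exact: (integrable_fin_num mD (intf i)).
by apply: (integrable_fin_num mD); exact: (integrable_sum mD s (fun i _ => intf i)).
Qed.

(** * The integral in a single coordinate *)

Definition corner_step {R : realType} (b : bool) (a x : R) : R :=
  (if b then x <= a else a <= x)%:R.

Definition corner_side {R : realType} (b : bool) (x : R) : R :=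
  if b then 1 - x else x.

(** The step cuts [0, 1] down to [0, a] or [a, 1], where the remaining power has an explicit
    polynomial primitive. *)
Lemma integral_corner_step (R : realType) (b : bool) (a : R) e : 0 <= a <= 1 ->
  (\int[lebesgue_measure]_(x in `[0%R, 1%R])
     (corner_step b a x * corner_side b x ^+ e)%:E =
   ((1 - corner_side b a ^+ e.+1) / e.+1%:R)%:E)%E.
Proof.
move=> /andP[a0 a1].
pose J : interval R := if b then `[0, a] else `[a, 1].
have -> : (\int[lebesgue_measure]_(x in `[0%R, 1%R])
     (corner_step b a x * corner_side b x ^+ e)%:E =
   \int[lebesgue_measure]_(x in [set` J]) (corner_side b x ^+ e)%:E)%E.
  rewrite integral_mkcond [RHS]integral_mkcond; apply: eq_integral => x _.
  rewrite !patchE !mem_setE /J /corner_step.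
  case: b {J}; rewrite !in_itv/=.
    have [x0|//] := leP 0 x; have [xa|ax] /= := leP x a.
      by rewrite (le_trans xa a1) mul1r.
    by rewrite mul0r; case: ifP.
  have [ax|xa] /= := leP a x; first by rewrite (le_trans a0 ax) mul1r.
  by rewrite mul0r; case: ifP.
(* A primitive of [corner_side b x ^+ e]; the minus sign offsets the derivative of 1 - X. *)
pose P : {poly R} := e.+1%:R^-1 *: (if b then - (1 - 'X) ^+ e.+1 else 'X ^+ e.+1).
have -> : (fun x => (corner_side b x ^+ e)%:E) = (fun x : R => (P^`().[x])%:E).
  apply/funext => x; congr EFin; rewrite /P /corner_side derivZ; case: b {J P}.
    rewrite derivN deriv_exp derivB derivX -polyC1 derivC sub0r.
    by rewrite !(hornerE, hornerMn, horner_exp)/= -mulr_natr; field.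
  by rewrite derivXn !(hornerE, hornerMn, horner_exp)/= -mulr_natr; field.
by rewrite /J /P; case: b {J P}; rewrite integral_deriv_horner//;
  rewrite !(hornerE, horner_exp)/= ?subr0 expr1n; congr EFin; field.
Qed.

Lemma measurable_corner_step (R : realType) b (a : R) :
  measurable_fun setT (corner_step b a).
Proof.
rewrite (_ : corner_step b a = \1_(if b then `]-oo, a]%classic else `[a, +oo[%classic)).
  by apply: measurable_indic; case: b.
by case: b; apply/funext => x; rewrite indicE mem_setE in_itv/= ?andbT.
Qed.

Lemma measurable_corner_side (R : realType) b :
  measurable_fun setT (@corner_side R b).
Proof. by rewrite /corner_side; case: b => //; exact: measurable_funB. Qed.

(** For [a] in the cube, membership is a conjunction of conditions on the coordinates, and one
    failing condition makes the product vanish. *)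
Lemma indic_cornerLe (R : realType) d (c : corner d) (x a : Rtuple R d) :
  unit_cube a ->
  \1_(cornerLe c x) a = \prod_(k < d) corner_step (c k) (tnth a k) (tnth x k).
Proof.
move=> Qa; rewrite indicE; case: (asboolP (cornerLe c x a)) => [ax|nax].
  rewrite mem_set// big1// => k _.
  by have [_ /(_ k)] := ax; rewrite /corner_step; case: (c k) => ->.
have /existsNP[k nk] : ~ forall k, if c k then tnth x k <= tnth a k
    else tnth a k <= tnth x k by move=> ?; exact: nax.
rewrite memNset// (bigD1 k)//= [X in X * _](_ : _ = 0) ?mul0r//.
by move: nk; rewrite /corner_step; case: (c k) => /negP/negbTE ->.
Qed.

(** * The integral over the cube of the general term *)

Section corner_product.
Context (R : realType) (d : nat) (c : corner d) (a : Rtuple R d) (e : nat).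
Context (Qa : unit_cube a).

Let f (x : Rtuple R d) := \1_(cornerLe c x) a * cdf_unif c x ^+ e.

Let fE x : f x = \prod_(k < d) (corner_step (c k) (tnth a k) (tnth x k) *
                             corner_side (c k) (tnth x k) ^+ e).
Proof. by rewrite /f indic_cornerLe// /cdf_unif -prodrXl -big_split. Qed.

Let mstep k : measurable_fun setT (fun t : R =>
  corner_step (c k) (tnth a k) t * corner_side (c k) t ^+ e).
Proof.
apply: measurable_funM; first exact: measurable_corner_step.
by apply: measurable_funX; exact: measurable_corner_side.
Qed.

Let step_ge0 k t : 0 <= t <= 1 ->
  0 <= corner_step (c k) (tnth a k) t * corner_side (c k) t ^+ e.
Proof.
move=> /andP[t0 t1]; rewrite mulr_ge0// exprn_ge0// /corner_side.
by case: (c k); rewrite ?subr_ge0.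
Qed.

Let integral_f : (\int[lebesgue_tuple d]_(x in @unit_cube R d) (f x)%:E =
  (\prod_(k < d) ((1 - corner_side (c k) (tnth a k) ^+ e.+1) / e.+1%:R))%:E)%E.
Proof.
under eq_integral => x _ do rewrite fE.
rewrite (@integral_unit_cube_prod R d (fun k t =>
  corner_step (c k) (tnth a k) t * corner_side (c k) t ^+ e))//.
rewrite -prodEFin; apply: eq_bigr => k _; exact: integral_corner_step.
Qed.

Lemma integrable_indic_cornerLe_cdf_unif :
  (lebesgue_tuple d).-integrable (@unit_cube R d)
    (fun x => (\1_(cornerLe c x) a * cdf_unif c x ^+ e)%:E).
Proof.
apply/integrableP; split.
  apply/measurable_EFinP; apply: measurable_funTS.
  rewrite [X in measurable_fun _ X](funext fE); apply: measurable_prod => k _.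
  by apply: measurableT_comp (mstep k) _; exact: measurable_tnth.
(* On the cube [f] is nonnegative, so the integral of its absolute value is the finite value just
   computed. *)
rewrite (eq_integral (fun x => (f x)%:E)) ?integral_f ?ltry// => x /set_mem Qx.
have f0 : 0 <= f x by rewrite fE prodr_ge0// => k _; exact: step_ge0.
by rewrite gee0_abs ?lee_fin.
Qed.

Lemma Rintegral_indic_cornerLe_cdf_unif :
  \int[lebesgue_tuple d]_(x in @unit_cube R d)
     (\1_(cornerLe c x) a * cdf_unif c x ^+ e) =
  \prod_(k < d) ((1 - corner_reflect c k (tnth a k) ^+ e.+1) / e.+1%:R).
Proof. by rewrite /Rintegral integral_f. Qed.

End corner_product.

(** * The pair, cross and square terms *)

Definition corner_meet {R : realType} {d} (c : corner d) (a b : Rtuple R d) : Rtuple R d :=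
  [tuple if c k then Num.min (tnth a k) (tnth b k)
         else Num.max (tnth a k) (tnth b k) | k < d].

Lemma unit_cube_corner_meet (R : realType) d (c : corner d) (a b : Rtuple R d) :
  unit_cube a -> unit_cube b -> unit_cube (corner_meet c a b).
Proof.
move=> Qa Qb k; have /andP[a0 a1] := Qa k; have /andP[b0 b1] := Qb k.
rewrite tnth_mktuple; case: (c k).
  by rewrite le_min ge_min a0 b0 a1.
by rewrite le_max ge_max a0 a1 b1.
Qed.

(** In each coordinate, two lower bounds hold together exactly when the minimum satisfies them, and
    two upper bounds exactly when the maximum does. A pair thus becomes a single point. *)
Lemma indic_cornerLe_meet (R : realType) d (c : corner d) (x a b : Rtuple R d) :
  unit_cube a -> unit_cube b ->
  \1_(cornerLe c x) (corner_meet c a b) =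
  \1_(cornerLe c x) a * \1_(cornerLe c x) b :> R.
Proof.
move=> Qa Qb; rewrite !indic_cornerLe//; last exact: unit_cube_corner_meet.
rewrite -big_split /=; apply: eq_bigr => k _; rewrite tnth_mktuple /corner_step.
by case: (c k); rewrite ?le_min ?ge_max -natrM mulnb.
Qed.

(** Reflection reverses the order exactly where the meet takes a minimum; this yields the maximum in
    [pairFactor]. *)
Lemma corner_reflect_meet (R : realType) d (c : corner d) (a b : Rtuple R d) k :
  corner_reflect c k (tnth (corner_meet c a b) k) =
  Num.max (corner_reflect c k (tnth a k)) (corner_reflect c k (tnth b k)).
Proof.
rewrite tnth_mktuple /corner_reflect; case: (c k) => //.
by rewrite -addr_maxr oppr_min.
Qed.

Lemma Rintegral_pair (R : realType) d (c : corner d) (a b : Rtuple R d) :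
  unit_cube a -> unit_cube b ->
  (lebesgue_tuple d).-integrable (@unit_cube R d)
    (EFin \o (fun x => \1_(cornerLe c x) a * \1_(cornerLe c x) b)) /\
  \int[lebesgue_tuple d]_(x in @unit_cube R d)
     (\1_(cornerLe c x) a * \1_(cornerLe c x) b) = pairFactor c a b.
Proof.
move=> Qa Qb; have Qm := unit_cube_corner_meet _ _ c _ _ Qa Qb.
have E x : \1_(cornerLe c x) a * \1_(cornerLe c x) b =
    \1_(cornerLe c x) (corner_meet c a b) * cdf_unif c x ^+ 0.
  by rewrite expr0 mulr1 indic_cornerLe_meet.
rewrite (funext E); split; first exact: integrable_indic_cornerLe_cdf_unif.
rewrite Rintegral_indic_cornerLe_cdf_unif//; apply: eq_bigr => k _.
by rewrite expr1 divr1 corner_reflect_meet.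
Qed.

Lemma Rintegral_cross (R : realType) d (c : corner d) (a : Rtuple R d) :
  unit_cube a ->
  (lebesgue_tuple d).-integrable (@unit_cube R d)
    (EFin \o (fun x => \1_(cornerLe c x) a * cdf_unif c x)) /\
  \int[lebesgue_tuple d]_(x in @unit_cube R d)
     (\1_(cornerLe c x) a * cdf_unif c x) = crossFactor c a.
Proof.
move=> Qa; split; first exact: (integrable_indic_cornerLe_cdf_unif _ _ c a 1 Qa).
exact: (Rintegral_indic_cornerLe_cdf_unif _ _ c a 1 Qa).
Qed.

Lemma Rintegral_cdf_unif_sqr (R : realType) d (c : corner d) :
  (lebesgue_tuple d).-integrable (@unit_cube R d)
    (EFin \o (fun x => cdf_unif c x ^+ 2)) /\
  \int[lebesgue_tuple d]_(x in @unit_cube R d) cdf_unif c x ^+ 2 = (1 / 3) ^+ d.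
Proof.
(* The corner itself lies in [cornerLe c x] for every [x] of the cube. Its reflected coordinates are
   all 0, so each factor is 1/3. *)
pose o : Rtuple R d := [tuple (c k)%:R | k < d].
have Qo : unit_cube o.
  by move=> k; rewrite tnth_mktuple; case: (c k); rewrite ?lexx ler01.
have E x : x \in @unit_cube R d ->
    \1_(cornerLe c x) o * cdf_unif c x ^+ 2 = cdf_unif c x ^+ 2.
  move=> /set_mem Qx; rewrite indicE mem_set ?mul1r//; split => // k.
  by rewrite tnth_mktuple; case: (c k); have /andP[] := Qx k.
split.
  apply: eq_integrable (integrable_indic_cornerLe_cdf_unif _ _ c o 2 Qo).
    exact: measurable_unit_cube.
  by move=> x Qx /=; rewrite E.
rewrite -(eq_Rintegral _ E) Rintegral_indic_cornerLe_cdf_unif//.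
rewrite -[in RHS](card_ord d) -prodr_const; apply: eq_bigr => k _.
rewrite tnth_mktuple /corner_reflect.
by case: (c k); rewrite ?subrr expr0n subr0.
Qed.

(** * Expansion of the square and integration term by term *)

Theorem theorem3p1 (R : realType) (d : nat) (hd : (1 <= d)%N) (c : corner d)
    (n : nat) (hn : (1 <= n)%N) (X : 'I_n -> Rtuple R d)
    (hX : forall i, unit_cube (X i)) :
  omega2 c X =
    1 / n%:R ^+ 2 * (\sum_(i < n) \sum_(j < n) pairFactor c (X i) (X j))
    - 2 / n%:R * (\sum_(i < n) crossFactor c (X i))
    + (1 / 3) ^+ d.
Proof.
have mQ := measurable_unit_cube R d.
pose A i (x : Rtuple R d) : R := \1_(cornerLe c x) (X i).
have intP i j := (Rintegral_pair _ _ c _ _ (hX i) (hX j)).1.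
have intC i := (Rintegral_cross _ _ c _ (hX i)).1.
have [intF intFE] := Rintegral_cdf_unif_sqr R d c.
have expand x : (cdf_emp c X x - cdf_unif c x) ^+ 2 =
    1 / n%:R ^+ 2 * (\sum_(i < n) \sum_(j < n) A i x * A j x)
    - 2 / n%:R * (\sum_(i < n) A i x * cdf_unif c x) + cdf_unif c x ^+ 2.
  (* Factoring turns the double sum into the square of the sum of the [A i x]; what remains is a
     field identity, with [n] nonzero by [hn]. *)
  under eq_bigr do rewrite -mulr_sumr.
  by rewrite -!mulr_suml /cdf_emp; field; rewrite pnatr_eq0 -lt0n.
have intPi i := integrable_sum_EFin _ _ _ (index_enum 'I_n) _ mQ (intP i).
have intPs := integrable_sum_EFin _ _ _ (index_enum 'I_n) _ mQ intPi.
have intCs := integrable_sum_EFin _ _ _ (index_enum 'I_n) _ mQ intC.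
have intZ r (g : Rtuple R d -> R) :
    (lebesgue_tuple d).-integrable (@unit_cube R d) (EFin \o g) ->
    (lebesgue_tuple d).-integrable (@unit_cube R d) (EFin \o (fun x => r * g x)).
  by move=> /(integrableZl mQ r).
(* Linearity of the real-valued integral requires integrability of each piece, supplied by the facts
   collected above. *)
rewrite /omega2 (funext expand) RintegralD//; last first.
  exact: integrableB (intZ _ _ intPs) (intZ _ _ intCs).
rewrite RintegralB//; [|exact: intZ..].
rewrite !RintegralZl// intFE !Rintegral_sum//.
congr (_ * _ - _ * _ + _); apply: eq_bigr => i _.
  rewrite Rintegral_sum//; last exact: intP.
  apply: eq_bigr => j _.
  by case: (Rintegral_pair _ _ c _ _ (hX i) (hX j)).
by case: (Rintegral_cross _ _ c _ (hX i)).
Qed.
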